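(* Let $Q=\{Q_0(x),\dots,Q_{n-1}(x)\}$, $\deg Q_k=k$, be a system of semiseparable polynomials satisfying $$\begin{bmatrix}G_k(x)\\Q_k(x)\end{bmatrix}=\begin{bmatrix}\alpha_k&\beta_k\\ \gamma_k&1\end{bmatrix}\begin{bmatrix}G_{k-1}(x)\\(\delta_kx+\theta_k)Q_{k-1}(x)\end{bmatrix},\qquad k=1,\dots,n-1 .$$ Then the following recurrence relations hold for the columns $\mathbf{s}_k$ of $S_{PQ}$ and $\mathbf{t}_k$ of $S_{PG}$, for all $k=1,\dots,n-1$: $$\mathbf{t}_{k+1}=\alpha_k\mathbf{t}_k+\beta_k(\delta_kZ_0+\theta_kI)\mathbf{s}_k,\qquad\mathbf{s}_{k+1}=\gamma_k\mathbf{t}_k+(\delta_kZ_0+\theta_kI)\mathbf{s}_k,$$ where $Z_0$ is the $n\times n$ lower shift matrix. As a consequence, all entries of $S_{PQ}$ can be computed in $\mathcal{O}(n^2)$ operations.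
   Context: $S_{PQ}$ is the $n\times n$ basis transformation matrix from $Q$ to the monomial basis $P=\{1,x,\dots,x^{n-1}\}$: its $j$-th column $\mathbf{s}_j$ contains the coefficients of $Q_{j-1}$, i.e. $Q_{j-1}(x)=\sum_{i=1}^n[S_{PQ}]_{ij}x^{i-1}$. Similarly $S_{PG}$ is the $n\times n$ matrix whose $j$-th column $\mathbf{t}_j$ contains the coefficients of the auxiliary polynomial $G_{j-1}$, $j=1,\dots,n$ (the $G_k$ have degree at most $n-1$). $Z_0$ has ones on the first subdiagonal and zeros elsewhere. Operations are arithmetic operations over $\mathbb{C}$; the recurrence coefficients and $Q_0,G_0$ are given. *)

(* Defs.v *)
From mathcomp Require Import all_boot all_order all_algebra.

Set Implicit Arguments.
Unset Strict Implicit.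
Unset Printing Implicit Defensive.

Import GRing.Theory.
Local Open Scope ring_scope.

(* Columns are numbered from 0: column [j] holds the coefficients of [P j], so
   that it is the column written s_(j+1) (or t_(j+1)) in the 1-based
   numbering. *)
Definition basis_mx (F : fieldType) (n : nat) (P : nat -> {poly F}) : 'M[F]_n :=
  \matrix_(i < n, j < n) (P j)`_i.

Lemma basis_mxE (F : fieldType) (n : nat) (P : nat -> {poly F}) (j : 'I_n) :
  (size (P j) <= n)%N -> P j = \sum_(i < n) basis_mx n P i j *: 'X^i.
Proof.
move=> leP; rewrite -[LHS](coefK (P j)) poly_def.
rewrite (big_ord_widen n (fun i => (P j)`_i *: 'X^i)) //.
rewrite big_mkcond /=; apply: eq_bigr => i _; rewrite mxE.
by case: ltnP => // /(nth_default 0) ->; rewrite scale0r.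
Qed.

Definition lower_shift (F : fieldType) (n : nat) : 'M[F]_n :=
  \matrix_(i < n, j < n) (i == j.+1 :> nat)%:R.

(* Only the values of [alpha], ..., [theta] at 1, ..., n-1 and those of [G] and
   [Q] at 0, ..., n-1 are constrained. *)
Record semiseparable (F : fieldType) (n : nat)
    (alpha beta gamma delta theta : nat -> F) (G Q : nat -> {poly F}) : Prop :=
  Semiseparable {
    semiseparable_degQ : forall k, (k < n)%N -> size (Q k) = k.+1;
    semiseparable_degG : forall k, (k < n)%N -> (size (G k) <= n)%N;
    semiseparable_rec : forall k, (0 < k < n)%N ->
      col_mx (G k)%:M (Q k)%:M =
      block_mx (alpha k)%:P%:M (beta k)%:P%:M
               (gamma k)%:P%:M 1%:M
      *m col_mx (G k.-1)%:M ((delta k *: 'X + (theta k)%:P) * Q k.-1)%:M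
      :> 'M[{poly F}]_(1 + 1, 1) }.

(* Algebraic complexity is measured on straight-line programs. The memory is
   initialised with the input; the instruction [Instr o i j] performs the one
   arithmetic operation [o] on the contents of cells [i] and [j] and appends
   the result to the memory, hence [size p] is the operation count of [p].
   There are no built-in constants. Reading a cell that does not exist and
   dividing by 0 are failures: the convention x / 0 = 0 is not available to
   programs. *)
Inductive arith_op := Add | Sub | Mul | Div.

Record instr := Instr { instr_op : arith_op; instr_l : nat; instr_r : nat }.

Definition slp := seq instr.

Definition eval_op (F : fieldType) (o : arith_op) (x y : F) : option F :=
  match o with
  | Add => Some (x + y)
  | Sub => Some (x - y)
  | Mul => Some (x * y)
  | Div => if y == 0 then None else Some (x / y)
  end.

Definition step (F : fieldType) (mem : seq F) (c : instr) : option (seq F) :=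
  match onth mem (instr_l c), onth mem (instr_r c) with
  | Some x, Some y => omap (rcons mem) (eval_op (instr_op c) x y)
  | _, _ => None
  end.

Definition run (F : fieldType) (p : slp) (input : seq F) : option (seq F) :=
  foldl (fun mem c => obind (fun s => step s c) mem) (Some input) p.

(* [out i j] is the address of the cell where the entry (i, j) is found when
   [p] terminates. *)
Definition computes_mx (F : fieldType) (p : slp) (input : seq F) (m n : nat)
    (out : nat -> nat -> nat) (A : 'M[F]_(m, n)) : Prop :=
  exists2 mem, run p input = Some mem &
    forall (i : 'I_m) (j : 'I_n), onth mem (out i j) = Some (A i j).

(* [Q0] is meant to be a constant and [G0] to have degree at most n-1. *)
Definition recurrence_data (F : fieldType) (n : nat)
    (alpha beta gamma delta theta : nat -> F) (G0 Q0 : {poly F}) : seq F :=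
  map alpha (iota 1 n.-1) ++ map beta (iota 1 n.-1) ++
  map gamma (iota 1 n.-1) ++ map delta (iota 1 n.-1) ++
  map theta (iota 1 n.-1) ++ Q0`_0 :: mkseq (nth 0 G0) n.

(* Main.v *)
Require Import Defs.
From mathcomp Require Import all_boot all_order all_algebra.
From mathcomp Require Import reals complex.
From mathcomp Require Import zify.

Set Implicit Arguments.
Unset Strict Implicit.
Unset Printing Implicit Defensive.

Import GRing.Theory.
Local Open Scope ring_scope.

(** The two rows of the polynomial recurrence express [G k.+1] and [Q k.+1] by
    [G k], [Q k] and ['X * Q k]. Taking coefficients is linear, and
    multiplication by ['X] moves every coefficient up by one place, which is
    what the lower shift does to a column of coefficients. So the relations
    between columns are the polynomial recurrence read on coefficients
    ([semiseparable_coef], [basis_mx_rec]). The shift loses the coefficient of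
    index [n.-1]; nothing is lost in the columns themselves, because they only
    record the coefficients of index less than [n], and those of ['X * Q k]
    depend on coefficients of [Q k] of smaller index.

    For the operation count, the coefficient of index [i] of [G k.+1] and of
    [Q k.+1] is obtained from three coefficients of the previous polynomials
    by eight operations, the product by ['X] being a mere change of address.
    There are [n.-1] steps with [n] coefficients each. One more operation,
    [x - x], produces the constant 0, which fills the places below the diagonal
    of the first column. This gives [8 * n * n.-1 + 1 <= 8 * n ^ 2] operations
    for [n > 0], and none for [n = 0].

    The program is a list of blocks of equal length, one for each pair [(k, i)]
    in lexicographic order, so a block only reads cells already written. Its
    correctness ([run_rec_prog]) is a single induction on the number of blocks
    run: the memory is the input, the constant 0, and the concatenation of the
    blocks of intended values, so it suffices that one block, run on such a
    memory, appends the next block of values. That the intended values are the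
    entries of the matrices is the coefficient recurrence
    ([onth_coef_memory]). *)

(** * The recurrence on coefficients *)

Lemma semiseparableE (F : fieldType) (n : nat)
    (alpha beta gamma delta theta : nat -> F) (G Q : nat -> {poly F}) (k : nat) :
    semiseparable n alpha beta gamma delta theta G Q -> (k.+1 < n)%N ->
  let r := (delta k.+1 *: 'X + (theta k.+1)%:P) * Q k in
  G k.+1 = alpha k.+1 *: G k + beta k.+1 *: r /\
  Q k.+1 = gamma k.+1 *: G k + r.
Proof.
case=> _ _ /(_ k.+1) + ltkn; rewrite ltkn => /(_ isT).
rewrite mul_block_col -!scalar_mxM mul1r -!raddfD /= => /eq_col_mx[].
move=> /matrixP/(_ 0 0) + /matrixP/(_ 0 0); rewrite !mxE !mulr1n => -> ->.
by rewrite !mul_polyC.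
Qed.

(** Multiplication by ['X] moves coefficient [i.-1] to coefficient [i]; this
    is the only place where the recurrence mixes coefficients. Keeping
    ['X * Q k] whole avoids a case distinction on [i = 0] in the statement. *)
Lemma semiseparable_coef (F : fieldType) (n : nat)
    (alpha beta gamma delta theta : nat -> F) (G Q : nat -> {poly F})
    (k i : nat) :
    semiseparable n alpha beta gamma delta theta G Q -> (k.+1 < n)%N ->
  let r := delta k.+1 * ('X * Q k)`_i + theta k.+1 * (Q k)`_i in
  (G k.+1)`_i = alpha k.+1 * (G k)`_i + beta k.+1 * r /\
  (Q k.+1)`_i = gamma k.+1 * (G k)`_i + r.
Proof.
move=> sepQ /(semiseparableE sepQ)[-> ->].
by rewrite mulrDl -scalerAl mul_polyC !(coefD, coefZ).
Qed.

(** The entries of the column are coefficients of index less than [n], so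
    those of the product by ['X] only involve coefficients that the column of
    [P j] records, whatever the degree of [P j]. *)
Lemma lower_shift_col (F : fieldType) (n : nat) (P : nat -> {poly F})
    (i j : 'I_n) :
  (lower_shift F n *m col j (basis_mx n P)) i 0 = ('X * P j)`_i.
Proof.
rewrite mxE coefXM.
under eq_bigr do rewrite !mxE.
case: i => [[|i] lt_i_n] /=.
  by rewrite big1 // => l _; rewrite mul0r.
rewrite (bigD1 (Ordinal (ltnW lt_i_n))) //= eqxx mul1r big1 ?addr0 // => l.
by rewrite -val_eqE /= eqSS eq_sym => /negPf->; rewrite mul0r.
Qed.

Lemma basis_mx_rec (F : fieldType) (n : nat)
    (alpha beta gamma delta theta : nat -> F) (G Q : nat -> {poly F})
    (k' k : 'I_n) :
    semiseparable n alpha beta gamma delta theta G Q -> k = k'.+1 :> nat ->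
  let M := delta k *: lower_shift F n + theta k *: 1%:M in
  col k (basis_mx n G) =
    alpha k *: col k' (basis_mx n G) + beta k *: (M *m col k' (basis_mx n Q))
  /\ col k (basis_mx n Q) =
    gamma k *: col k' (basis_mx n G) + M *m col k' (basis_mx n Q).
Proof.
move=> sepQ def_k M.
have lt_k'n: (k'.+1 < n)%N by rewrite -def_k.
have MqE i: (M *m col k' (basis_mx n Q)) i 0
    = delta k * ('X * Q k')`_i + theta k * (Q k')`_i.
  rewrite mulmxDl -!scalemxAl mul1mx mxE [X in X + _]mxE lower_shift_col.
  by rewrite !mxE.
have scaleE c (v : 'cV[F]_n) i : (c *: v) i 0 = c * v i 0 by rewrite mxE.
have addE (u v : 'cV[F]_n) i : (u + v) i 0 = u i 0 + v i 0 by rewrite mxE.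
split; apply/colP => i; have [Gki Qki] := semiseparable_coef i sepQ lt_k'n;
  by rewrite addE !scaleE MqE !mxE def_k ?Gki ?Qki.
Qed.

(** * Running straight-line programs *)

Lemma run_cons (F : fieldType) (o : arith_op) (l r : nat) (p : slp)
    (mem : seq F) (x y z : F) :
    onth mem l = Some x -> onth mem r = Some y -> eval_op o x y = Some z ->
  run (Instr o l r :: p) mem = run p (rcons mem z).
Proof. by move=> meml memr oxy; rewrite /run /= /step meml memr /= oxy. Qed.

Lemma run_cat (F : fieldType) (p q : slp) (mem mem' : seq F) :
  run p mem = Some mem' -> run (p ++ q) mem = run q mem'.
Proof. by rewrite /run foldl_cat => ->. Qed.

(** Induction on the number of blocks. The blocks are described by the values
    [v j] that they append rather than by their effect, so that a single
    closed form of the memory serves as the invariant. *)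
Lemma run_flatten (F : fieldType) (p : nat -> slp) (v : nat -> seq F)
    (mem : seq F) (N : nat) :
    (forall j, (j < N)%N -> run (p j) (mem ++ flatten (mkseq v j)) =
                            Some ((mem ++ flatten (mkseq v j)) ++ v j)) ->
  run (flatten (mkseq p N)) mem = Some (mem ++ flatten (mkseq v N)).
Proof.
elim: N => [|N IHN] runP; first by rewrite cats0.
rewrite !mkseqS !flatten_rcons.
rewrite (run_cat _ (IHN _)) ?runP ?catA // => j ltjN.
by apply: runP; apply: ltnW.
Qed.

Lemma onth_catl (T : Type) (s1 s2 : seq T) (a : nat) (x : T) :
  onth s1 a = Some x -> onth (s1 ++ s2) a = Some x.
Proof.
move=> s1a; rewrite onth_cat ifT //.
by rewrite -onthTE s1a.
Qed.

Lemma onth_catr (T : Type) (s1 s2 : seq T) (r : nat) :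
  onth (s1 ++ s2) (size s1 + r) = onth s2 r.
Proof. by rewrite onth_cat ltnNge leq_addr addKn. Qed.

Lemma size_flatten_mkseq (T : Type) (w : nat) (v : nat -> seq T) (N : nat) :
  (forall i, size (v i) = w) -> size (flatten (mkseq v N)) = (w * N)%N.
Proof.
move=> size_v; elim: N => [|N IHN]; first by rewrite muln0.
by rewrite mkseqS flatten_rcons size_cat IHN size_v mulnS addnC.
Qed.

Lemma onth_flatten (T : Type) (w : nat) (v : nat -> seq T) (N j r : nat) :
    (forall i, size (v i) = w) -> (j < N)%N -> (r < w)%N ->
  onth (flatten (mkseq v N)) (w * j + r) = onth (v j) r.
Proof.
move=> size_v ltjN ltrw; elim: N ltjN => // N IHN.
rewrite ltnS mkseqS flatten_rcons.
have size_flat := size_flatten_mkseq N size_v.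
rewrite leq_eqVlt => /predU1P[->|ltjN]; first by rewrite -size_flat onth_catr.
rewrite onth_cat ifT ?IHN // size_flat.
apply: leq_trans (_ : w * j.+1 <= _)%N; last by rewrite leq_mul2l ltjN orbT.
by rewrite mulnS addnC ltn_add2r.
Qed.

Lemma onth_map_iota (T : Type) (f : nat -> T) (m N i : nat) :
  (i < N)%N -> onth (map f (iota m N)) i = Some (f (m + i)%N).
Proof.
by move=> ltiN; rewrite onth_map onthE (nth_map 0%N) ?size_iota ?nth_iota.
Qed.

(** * A program for the recurrence *)

(** One coefficient of one step of the recurrence. The arguments are the
    addresses of the five recurrence coefficients, of the coefficients of
    [G k], [Q k] and ['X * Q k], and of the first cell to be written. The
    coefficient of [Q k.+1] ends up in cell [z + 4], that of [G k.+1] in cell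
    [z + 7]. *)
Definition rec_block (a b g d h t s s' z : nat) : slp :=
  [:: Instr Mul d s'; Instr Mul h s; Instr Add (z + 0) (z + 1);
      Instr Mul g t; Instr Add (z + 3) (z + 2);
      Instr Mul a t; Instr Mul b (z + 2); Instr Add (z + 5) (z + 6)].

Definition rec_values (F : fieldType) (a b g d h t s s' : F) : seq F :=
  let r := d * s' + h * s in
  [:: d * s'; h * s; r; g * t; g * t + r; a * t; b * r; a * t + b * r].

Lemma run_rec_block (F : fieldType) (mem : seq F)
    (a b g d h t s s' : nat) (xa xb xg xd xh xt xs xs' : F) :
    onth mem a = Some xa -> onth mem b = Some xb -> onth mem g = Some xg ->
    onth mem d = Some xd -> onth mem h = Some xh -> onth mem t = Some xt ->
    onth mem s = Some xs -> onth mem s' = Some xs' ->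
  run (rec_block a b g d h t s s' (size mem)) mem =
  Some (mem ++ rec_values xa xb xg xd xh xt xs xs').
Proof.
move=> ma mb mg md mh mt ms ms'.
have old u c x : onth mem c = Some x -> onth (mem ++ u) c = Some x.
  exact: onth_catl.
(* Writing the memory as [mem ++ u] tells the two kinds of operand apart: an
   address in [mem], or an offset into the part [u] that grows. *)
rewrite /rec_block -[X in run _ X]cats0.
do 8 (etransitivity;
  [eapply run_cons;
     [ first [eapply old; eassumption | rewrite onth_catr; reflexivity]
     | first [eapply old; eassumption | rewrite onth_catr; reflexivity]
     | reflexivity ]
  | rewrite rcons_cat [rcons _ _]/=]).
by [].
Qed.

(** Addresses in the memory for [n = m.+1]. The input occupies [6 * m + 2]
    cells and is followed by a cell holding 0, which serves for the
    coefficients of [Q 0] of positive degree and for the constant coefficient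
    of ['X * Q k]. After that, the coefficients of index [i] of [Q k.+1] and of
    [G k.+1] share a block of 8 cells; the blocks come in lexicographic order
    of [(k, i)]. *)
Definition zero_addr (m : nat) : nat := 6 * m + 2.

Definition block_addr (m j : nat) : nat := (zero_addr m).+1 + 8 * j.

Definition Q_addr (m k i : nat) : nat :=
  if k is k'.+1 then block_addr m (k' * m.+1 + i) + 4
  else if i is 0 then 5 * m else zero_addr m.

Definition G_addr (m k i : nat) : nat :=
  if k is k'.+1 then block_addr m (k' * m.+1 + i) + 7 else (5 * m).+1 + i.

Definition XQ_addr (m k i : nat) : nat :=
  if i is i'.+1 then Q_addr m k i' else zero_addr m.

Definition coef_block (m j : nat) : slp :=
  let k := (j %/ m.+1)%N in let i := (j %% m.+1)%N in
  rec_block k (m + k) (2 * m + k) (3 * m + k) (4 * m + k)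
            (G_addr m k i) (Q_addr m k i) (XQ_addr m k i) (block_addr m j).

Definition rec_prog (n : nat) : slp :=
  if n is m.+1 then
    Instr Defs.Sub 0 0 :: flatten (mkseq (coef_block m) (m * m.+1))
  else [::].

Lemma size_rec_prog (n : nat) : (size (rec_prog n) <= 8 * n ^ 2)%N.
Proof.
case: n => //= m; rewrite (@size_flatten_mkseq _ 8) //.
nia.
Qed.

Lemma size_recurrence_data (F : fieldType) (m : nat)
    (alpha beta gamma delta theta : nat -> F) (G0 Q0 : {poly F}) :
  size (recurrence_data m.+1 alpha beta gamma delta theta G0 Q0) = zero_addr m.
Proof.
rewrite /recurrence_data !size_cat /= !size_map !size_iota /zero_addr /=; lia.
Qed.

Lemma onth_recurrence_data (F : fieldType) (m : nat)
    (alpha beta gamma delta theta : nat -> F) (G0 Q0 : {poly F}) :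
  let mem := recurrence_data m.+1 alpha beta gamma delta theta G0 Q0 in
  [/\ forall k, (k < m)%N ->
        [/\ onth mem k = Some (alpha k.+1), onth mem (m + k) = Some (beta k.+1),
            onth mem (2 * m + k) = Some (gamma k.+1),
            onth mem (3 * m + k) = Some (delta k.+1) &
            onth mem (4 * m + k) = Some (theta k.+1)],
      onth mem (5 * m) = Some Q0`_0 &
      forall i, (i < m.+1)%N -> onth mem ((5 * m).+1 + i) = Some G0`_i].
Proof.
have skip (f : nat -> F) s a :
    onth (map f (iota 1 m) ++ s) (m + a) = onth s a.
  by rewrite -{2}(size_iota 1 m) -(size_map f) onth_catr.
rewrite /recurrence_data [m.+1.-1]/=; split=> [k ltkm||i lti].
- split; rewrite ?mulSn ?mul0n -?addnA ?add0n ?skip;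
    by apply: onth_catl; rewrite onth_map_iota.
- by rewrite !mulSn mul0n !skip.
- rewrite !mulSn mul0n addn0 addSn -addnS -!addnA !skip /=.
  by rewrite onth_map_iota.
Qed.

(** The intended values are written with the polynomials themselves, not with
    what the preceding blocks computed; the correctness of a block is then
    independent of the others, except for the lookup of its operands. *)
Definition coef_values (F : fieldType) (m : nat)
    (alpha beta gamma delta theta : nat -> F) (G Q : nat -> {poly F})
    (j : nat) : seq F :=
  let k := (j %/ m.+1)%N in let i := (j %% m.+1)%N in
  rec_values (alpha k.+1) (beta k.+1) (gamma k.+1) (delta k.+1) (theta k.+1)
             (G k)`_i (Q k)`_i ('X * Q k)`_i.

(** After [N] blocks, every pair [(k, i)] before position [N + m.+1] is
    available: the shift by [m.+1], the length of a column, accounts for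
    column 0, found in the input and the constant 0. For the other columns, the
    polynomial recurrence identifies the cells 4 and 7 of a block with the
    coefficients of the next two polynomials. *)
Lemma onth_coef_memory (F : fieldType) (m : nat)
    (alpha beta gamma delta theta : nat -> F) (G Q : nat -> {poly F})
    (N k i : nat) :
    semiseparable m.+1 alpha beta gamma delta theta G Q ->
    (k < m.+1)%N -> (i < m.+1)%N -> (k * m.+1 + i < N + m.+1)%N ->
  let mem :=
    rcons (recurrence_data m.+1 alpha beta gamma delta theta (G 0%N) (Q 0%N)) 0
    ++ flatten (mkseq (coef_values m alpha beta gamma delta theta G Q) N) in
  [/\ onth mem (Q_addr m k i) = Some (Q k)`_i,
      onth mem (G_addr m k i) = Some (G k)`_i &
      onth mem (zero_addr m) = Some 0].
Proof.
move=> sepQ ltkn ltin ltkiN mem.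
have mem_zero: onth mem (zero_addr m) = Some 0.
  apply: onth_catl; rewrite -cats1.
  by rewrite -(size_recurrence_data m alpha beta gamma delta theta (G 0%N)
    (Q 0%N)) -[X in onth _ X]addn0 onth_catr.
have [_ data_Q data_G] :=
  onth_recurrence_data m alpha beta gamma delta theta (G 0%N) (Q 0%N).
case: k ltkn ltkiN => [|k] ltkn ltkiN; split=> //.
- case: i ltin {ltkiN} => [|i] ltin.
    by rewrite /mem -cats1 -catA; apply: onth_catl.
  (* [Q 0] is a constant, so its other coefficients are the 0 of the memory *)
  rewrite /= mem_zero nth_default //.
  by case: sepQ => /(_ 0%N isT)->.
- by rewrite /mem -cats1 -catA; apply: onth_catl; apply: data_G.
all: rewrite /Q_addr /G_addr /block_addr /mem.
all: rewrite -(size_recurrence_data m alpha beta gamma delta theta (G 0%N)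
  (Q 0%N)) -(size_rcons _ 0) -addnA onth_catr onth_flatten //;
  last by rewrite mulSn in ltkiN; lia.
all: rewrite /coef_values divnMDl // divn_small // addn0 modnMDl modn_small //.
all: by have [Gki Qki] := semiseparable_coef i sepQ ltkn; rewrite ?Gki ?Qki.
Qed.

Lemma run_rec_prog (F : fieldType) (m : nat)
    (alpha beta gamma delta theta : nat -> F) (G Q : nat -> {poly F}) :
    semiseparable m.+1 alpha beta gamma delta theta G Q ->
  let data := recurrence_data m.+1 alpha beta gamma delta theta (G 0%N) (Q 0%N)
  in run (rec_prog m.+1) data =
     Some (rcons data 0 ++
       flatten (mkseq (coef_values m alpha beta gamma delta theta G Q)
                      (m * m.+1))).
Proof.
move=> sepQ data.
have data_ne: (0 < size data)%N by rewrite size_recurrence_data /zero_addr addn2.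
have data0: onth data 0 = Some (head 0 data) by case: data data_ne.
have sub0: eval_op Defs.Sub (head 0 data) (head 0 data) = Some 0.
  by rewrite /= subrr.
rewrite /rec_prog (run_cons _ data0 data0 sub0).
apply: run_flatten => j ltj.
set k := (j %/ m.+1)%N; set i := (j %% m.+1)%N.
have def_j: j = (k * m.+1 + i)%N by apply: divn_eq.
have ltkm: (k < m)%N by rewrite ltn_divLR.
have ltin: (i < m.+1)%N by apply: ltn_pmod.
have [/(_ k ltkm)[da db dg dd dh] _ _] :=
  onth_recurrence_data m alpha beta gamma delta theta (G 0%N) (Q 0%N).
set mem := _ ++ flatten _.
have old a x : onth data a = Some x -> onth mem a = Some x.
  by move=> dx; rewrite /mem -cats1 -catA; apply: onth_catl.
have memP l : (l <= i)%N ->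
    [/\ onth mem (Q_addr m k l) = Some (Q k)`_l,
        onth mem (G_addr m k l) = Some (G k)`_l &
        onth mem (zero_addr m) = Some 0].
  move=> leli; apply: onth_coef_memory => //; lia.
have -> : coef_block m j =
    rec_block k (m + k) (2 * m + k) (3 * m + k) (4 * m + k)
      (G_addr m k i) (Q_addr m k i) (XQ_addr m k i) (size mem).
  congr rec_block; rewrite size_cat size_rcons size_recurrence_data.
  by rewrite (@size_flatten_mkseq _ 8).
have [Qi Gi zi] := memP i (leqnn i).
apply: run_rec_block => //; try exact: old.
(* The eighth operand is the coefficient of ['X * Q k]: the constant 0 when
   [i] is 0, otherwise the previous coefficient of [Q k]. *)
rewrite coefXM -/i -/k /XQ_addr; case def_i: i => [|i'] /=; first by rewrite zi.
by have [] := memP i'; rewrite ?def_i.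
Qed.

Theorem lemma5p2 (R : realType) :
  (forall (n : nat) (alpha beta gamma delta theta : nat -> R[i])
      (G Q : nat -> {poly R[i]}),
    semiseparable n alpha beta gamma delta theta G Q ->
    forall k' k : 'I_n, k = k'.+1 :> nat ->
      col k (basis_mx n G) =
        alpha k *: col k' (basis_mx n G)
        + beta k *: ((delta k *: lower_shift R[i] n + theta k *: 1%:M)
                     *m col k' (basis_mx n Q))
      /\
      col k (basis_mx n Q) =
        gamma k *: col k' (basis_mx n G)
        + (delta k *: lower_shift R[i] n + theta k *: 1%:M)
          *m col k' (basis_mx n Q))
  /\
  (exists (c : nat) (p : nat -> slp) (out : nat -> nat -> nat -> nat),
    forall n : nat,
      (size (p n) <= c * n ^ 2)%N /\
      forall (alpha beta gamma delta theta : nat -> R[i])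
        (G Q : nat -> {poly R[i]}),
        semiseparable n alpha beta gamma delta theta G Q ->
        computes_mx (p n)
          (recurrence_data n alpha beta gamma delta theta (G 0%N) (Q 0%N))
          (out n) (basis_mx n Q)).
Proof.
split; first by move=> n *; apply: basis_mx_rec.
exists 8, rec_prog, (fun n i j => Q_addr n.-1 j i) => n.
split=> [|alpha beta gamma delta theta G Q sepQ].
  exact: size_rec_prog.
case: n sepQ => [|m] sepQ; first by eexists; [reflexivity | case].
eexists; first exact: run_rec_prog.
move=> i j; rewrite mxE.
have ltj: (j * m.+1 + i < m * m.+1 + m.+1)%N.
  have := ltn_ord j; have := ltn_ord i; nia.
by have [] := onth_coef_memory sepQ (ltn_ord j) (ltn_ord i) ltj.
Qed.
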